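(* Let $K$ be an algebraically closed field, let $R=K[x_1,\dots,x_N]$ be a polynomial ring over $K$, let $m\le n$ be positive integers, and let $X$ be an $(m\times n)$-matrix with entries in $R$. Let $t$ be an integer such that $1\le t\le m$ and $t<n$. Suppose that the entries of $X$ lying outside the $(t\times t)$-submatrix formed by the last $t$ rows (indices $m-t+1,\dots,m$) and the last $t$ columns (indices $n-t+1,\dots,n$) are algebraically dependent over $K$. Then \[ \operatorname{ara} I_t(X)\le mn-t^2 . \]
   Context: $I_t(X)$ denotes the ideal of $R$ generated by all $t$-minors of $X$, i.e. the determinants of all $(t\times t)$-submatrices of $X$. For an ideal $I$ of a Noetherian ring $S$, the arithmetical rank $\operatorname{ara} I$ is the minimum number $r$ of elements $f_1,\dots,f_r\in S$ such that $\sqrt{I}=\sqrt{(f_1,\dots,f_r)}$. Entries of $X$ are called algebraically dependent over $K$ if, regarded as a family indexed by their positions in the matrix, there are entries $u_1,\dots,u_k$ in the family (at distinct positions) and a nonzero polynomial $F$ over $K$ in $k$ indeterminates such that $F(u_1,\dots,u_k)=0$. *)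

(* Defs.v *)
From mathcomp Require Import all_boot all_order all_algebra.
From mathcomp Require Import mpoly.

Set Implicit Arguments.
Unset Strict Implicit.
Unset Printing Implicit Defensive.

Import GRing.Theory.
Local Open Scope ring_scope.

(* Ideals are Prop-valued subsets: the boolean [idealr] structure of
   [ring_quotient] requires decidable membership and excludes the unit ideal. *)
Definition ideal_gen (S : comNzRingType) (G : S -> Prop) : S -> Prop :=
  fun x => exists (k : nat) (c g : 'I_k -> S),
    (forall i, G (g i)) /\ x = \sum_(i < k) c i * g i.

Definition radical (S : comNzRingType) (I : S -> Prop) : S -> Prop :=
  fun x => exists e : nat, (0 < e)%N /\ I (x ^+ e).

Definition generates_up_to_radical (S : comNzRingType) (I : S -> Prop)
    (r : nat) (f : 'I_r -> S) : Prop :=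
  forall x : S,
    radical I x <-> radical (ideal_gen (fun y => exists i, y = f i)) x.

(* [is_ara I r] says [ara I = r].  It is a relation because the minimum need
   not exist when [S] is not Noetherian. *)
Definition is_ara (S : comNzRingType) (I : S -> Prop) (r : nat) : Prop :=
  (exists f : 'I_r -> S, generates_up_to_radical I f) /\
  (forall (s : nat) (f : 'I_s -> S), generates_up_to_radical I f -> (r <= s)%N).

(* Strictly increasing [f] and [g] enumerate the chosen rows and columns. *)
Definition is_minor (S : comNzRingType) (m n : nat) (X : 'M[S]_(m, n))
    (t : nat) (d : S) : Prop :=
  exists (f : 'I_t -> 'I_m) (g : 'I_t -> 'I_n),
    [/\ {homo f : i j / (i < j)%N}, {homo g : i j / (i < j)%N}
      & d = \det (mxsub f g X)].

Definition minor_ideal (S : comNzRingType) (m n : nat) (X : 'M[S]_(m, n))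
    (t : nat) : S -> Prop :=
  ideal_gen (is_minor X t).

(* Indices start at 0, so the last [t] of [m] rows are those with
   [m - t <= i]. *)
Definition in_last_block (m n t : nat) (p : 'I_m * 'I_n) : bool :=
  (m - t <= p.1)%N && (n - t <= p.2)%N.

(* The entries at the positions satisfying [P] are algebraically dependent
   over [K] as a family: equal entries at distinct positions count as
   dependent. *)
Definition entries_alg_dependent (K : fieldType) (N m n : nat)
    (X : 'M[{mpoly K[N]}]_(m, n)) (P : pred ('I_m * 'I_n)) : Prop :=
  exists (k : nat) (u : 'I_k -> 'I_m * 'I_n) (F : {mpoly K[k]}),
    [/\ injective u, forall i, P (u i), F != 0
      & F \mPo [tuple X (u i).1 (u i).2 | i < k] = 0].

(* Main.v *)
(* Write d = m n - t^2, call the entries of X outside the last t x t block the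
   outer entries, and let delta be the determinant of that block.  Over a field,
   the nonzero minors of a matrix have a componentwise smallest one, obtained by
   choosing greedily each row and each column that is not spanned by the
   preceding ones.  Hence, if f_w is the sum of all minors of size at least t and
   weight w, for a weight that strictly decreases along the componentwise order
   (Bruns and Schwaenzl), then the vanishing of f_w for t^2 < w <= m n, which are
   d conditions, forces the rank to be below t, unless all outer entries vanish
   and delta does not.

   The algebraic dependence removes the exception.  Let X' be X with the outer
   entry x_l replaced by x_l - v^(q^l), where v is a multiple of delta; then X'
   and X agree where delta vanishes, and the d elements f_w(X') define the locus
   of I_t(X) as soon as the outer entries never equal the v^(q^l) where delta
   does not vanish.  If F is the relation between the outer entries, then
   F(s^(q^0), s^(q^1), ...) = s^r W(s) with W(0) <> 0 for q large, and
   v = - delta W(x_0) works: the equalities would give s = - delta W(s) and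
   s^r W(s) = 0 for s = x_0 = v, hence s = 0 and delta W(0) = 0. *)
From HB Require Import structures.
Require Import Defs.
From mathcomp Require Import all_boot all_order all_algebra.
From mathcomp Require Import generic_quotient ring_quotient fraction.
From mathcomp Require classical_sets.
From mathcomp Require Import boolp.
From mathcomp Require Import mpoly zify.

Set Implicit Arguments.
Unset Strict Implicit.
Unset Printing Implicit Defensive.

Import GRing.Theory.
Local Open Scope ring_scope.

(** * Radicals and field-valued points *)

(** The embedding is the one into the fraction field. That construction needs a unit ring structure,
    so units are decided and inverses chosen classically, with [inv] the identity off the units. *)
Lemma domain_embeds_in_field (Q : comNzRingType)
    (domQ : GRing.integral_domain_axiom Q) :
  exists (F : fieldType) (phi : {rmorphism Q -> F}), injective phi.
Proof.
pose unit : {pred Q} := fun x => `[< exists y, y * x = 1 >].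
pose inv (x : Q) := if pselect (exists y, y * x = 1) is left ex
  then projT1 (cid ex) else x.
have mulVx : {in unit, left_inverse 1 inv *%R}.
  move=> x /asboolP xU; rewrite /inv.
  by case: pselect => // ex; case: cid.
have unitPl x y : y * x = 1 -> unit x by move=> yx; apply/asboolP; exists y.
have invr_out : {in [predC unit], inv =1 id}.
  move=> x; rewrite !inE => /negP xU; rewrite /inv.
  by case: pselect => // ex; case: xU; apply/asboolP.
pose U := HB.pack_for comUnitRingType Q
  (GRing.ComNzRing_hasMulInverse.Build Q mulVx unitPl invr_out).
pose D := HB.pack_for idomainType U
  (GRing.ComUnitRing_isIntegral.Build U domQ).
exists {fraction D}, (@FracField.tofrac D : {rmorphism D -> {fraction D}}).
by move=> x y /eqP; rewrite tofrac_eq => /eqP.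
Qed.

(** The point is the quotient map by [B] followed by an embedding of the quotient domain into a
    field. *)
Lemma prime_ideal_field_point (S : comNzRingType) (B : {pred S})
    (idB : idealr_closed B) (primeB : prime_idealr_closed B) :
  exists (F : fieldType) (phi : {rmorphism S -> F}),
    forall x, (phi x == 0) = (x \in B).
Proof.
pose I := HB.pack_for (prime_idealr S) B
  (isIdealr.Build S B idB) (isPrimeIdealrClosed.Build S B primeB).
have [F [phi phi_inj]] :=
  domain_embeds_in_field (@Quotient.rquot_IdomainAxiom S I).
pose piI : {rmorphism S -> {ideal_quot I}} := \pi_{ideal_quot I}%qT.
exists F, (phi \o piI : {rmorphism S -> F}) => x /=.
rewrite -[X in _ == X](rmorph0 phi) (inj_eq phi_inj).
by rewrite -(rmorph0 piI) -Quotient.idealrBE subr0.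
Qed.

Definition ideal_set (S : comNzRingType) (B : S -> Prop) :=
  B 0 /\ forall a u v, B u -> B v -> B (a * u + v).

Lemma ideal_gen_ideal_set (S : comNzRingType) (G : S -> Prop) :
  ideal_set (ideal_gen G).
Proof.
split=> [|a _ _ [k [c [g [Gg ->]]]] [l [d [h [Gh ->]]]]].
  exists 0, (fun=> 0), (fun=> 0); split; first by case.
  by rewrite big_ord0.
exists (k + l)%N, (fun i => match split i with inl j => a * c j | inr j => d j end),
  (fun i => match split i with inl j => g j | inr j => h j end); split.
  by move=> i; case: split.
rewrite big_split_ord /= mulr_sumr; congr (_ + _); apply: eq_bigr => i _.
  by rewrite (unsplitK (inl i : 'I_k + 'I_l)) mulrA.
by rewrite (unsplitK (inr i : 'I_k + 'I_l)).
Qed.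

Lemma mem_ideal_gen (S : comNzRingType) (G : S -> Prop) x :
  G x -> ideal_gen G x.
Proof.
move=> Gx; exists 1, (fun=> 1), (fun=> x).
by split=> //; rewrite big_ord1 mul1r.
Qed.

Lemma rmorph_ideal_gen0 (S : comNzRingType) (F : nzRingType)
    (phi : {rmorphism S -> F}) (G : S -> Prop) :
  (forall x, G x -> phi x = 0) -> forall x, ideal_gen G x -> phi x = 0.
Proof.
move=> phiG _ [k [c [g [Gg ->]]]]; rewrite rmorph_sum big1 // => i _.
by rewrite rmorphM (phiG _ (Gg i)) mulr0.
Qed.

(** By Zorn's lemma some ideal is maximal among those containing [J] and no power of [x]. It is
    prime: if it contained neither [u] nor [v], adjoining either would capture a power of [x], and
    the product of these two powers would lie in the ideal generated by it and [u * v]. *)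
Lemma exists_prime_ideal (S : comNzRingType) (J : S -> Prop) (x : S)
    (idJ : ideal_set J) (J'x : forall e, ~ J (x ^+ e)) :
  exists B : {pred S}, [/\ idealr_closed B, prime_idealr_closed B,
    forall y, J y -> y \in B & x \notin B].
Proof.
pose avoid (A : S -> Prop) := ideal_set A /\ forall e, ~ A (x ^+ e).
pose U (C : (S -> Prop) -> Prop) y := exists2 X, C X & X y.
(* Zorn's lemma is applied to all chains, including the empty one, whose union is empty. Joining [J]
   turns that union into [J], which does avoid the powers of [x]. *)
pose J' (A : S -> Prop) y := J y \/ A y.
have [|A [[[A0 Alin] A'x] maxA]] := @classical_sets.Zorn_bigcup S (fun A => avoid (J' A)).
  move=> C CP totC; rewrite -[classical_sets.bigcup _ _]/(U C); split; last first.
    by move=> e [/J'x//|[Y CY Ye]]; case: (CP Y CY) => _ /(_ e); apply; right.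
  split; first by left; case: idJ.
  move=> a u v Du Dv.
  have incl Y : C Y -> forall y, J' Y y -> J' (U C) y.
    by move=> CY y [Jy|Yy]; [left|right; exists Y].
  have single y : J' (U C) y ->
      J y \/ exists2 Y, C Y & J' Y y.
    by move=> [|[Y CY Yy]]; [left|right; exists Y => //; right].
  case: (single _ Du) => [Ju|[Y CY Yu]]; case: (single _ Dv) => [Jv|[Z CZ Zv]].
  - by left; apply: (proj2 idJ).
  - by apply: (incl _ CZ); apply: (CP Z CZ).1.2 => //; left.
  - by apply: (incl _ CY); apply: (CP Y CY).1.2 => //; left.
  case: (totC _ _ CY CZ) => YZ.
  - apply: (incl _ CZ); apply: (CP Z CZ).1.2 => //.
    by case: Yu => [|/YZ]; [left|right].
  - apply: (incl _ CY); apply: (CP Y CY).1.2 => //.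
    by case: Zv => [|/YZ]; [left|right].
have extend u : ~ J' A u -> exists e b r, J' A b /\ x ^+ e = r * u + b.
  move=> A'u; apply: contrapT => no.
  (* [D] is the ideal generated by [J' A] and [u]; it is strictly larger than [A], so maximality
     forces a power of [x] into it. *)
  pose D y := exists b r, J' A b /\ y = r * u + b.
  have AD y : J' A y -> D y by exists y, 0; rewrite mul0r add0r.
  apply: (maxA D).
    split; first by move=> y Ay; apply: AD; right.
    move=> DA; apply: A'u; right; apply: DA.
    by exists 0, 1; rewrite mul1r addr0.
  have -> : J' D = D.
    by apply/funext => y; apply/propext; split=> [[?|//]|]; [apply: AD; left|right].
  split; last by move=> e [b [r [Ab xE]]]; apply: no; exists e, b, r.
  split; first exact: AD.
  move=> a _ _ [b [r [Ab ->]]] [c [s [Ac ->]]].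
  exists (a * b + c), (a * r + s); split; first exact: Alin.
  by rewrite mulrDr mulrDl !mulrA addrACA.
exists (fun y => `[< J' A y >]); split.
- split; first exact/asboolP.
    by apply/negP => /asboolP; rewrite -(expr0 x); apply: A'x.
  by move=> a u v /asboolP Au /asboolP Av; apply/asboolP; apply: Alin.
- move=> u v /asboolP Auv; apply/orP; apply: contrapT => /not_orP[A'u A'v].
  have [|e [b [r [Ab xe]]]] := @extend u; first by move=> /asboolP.
  have [|f [c [s [Ac xf]]]] := @extend v; first by move=> /asboolP.
  apply: (A'x (e + f)%N); rewrite exprD xe xf.
  have -> : (r * u + b) * (s * v + c) =
      (r * s) * (u * v) + ((r * u + b) * c + ((s * v) * b + 0)).
    rewrite addr0 mulrDr [X in X + _ = _]mulrDl addrAC -!addrA; congr (_ + _).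
      by rewrite mulrACA.
    by rewrite [b * _]mulrC.
  exact: Alin (Auv) (Alin _ _ _ Ac (Alin _ _ _ Ab A0)).
- by move=> y Jy; apply/asboolP; left.
- by apply/negP => /asboolP; rewrite -(expr1 x); apply: A'x.
Qed.

Lemma radical_field_points (S : comNzRingType) (G : S -> Prop) (x : S) :
  (forall (F : fieldType) (phi : {rmorphism S -> F}),
     (forall y, G y -> phi y = 0) -> phi x = 0) ->
  radical (ideal_gen G) x.
Proof.
move=> Gx; apply: contrapT => radx.
have [|B [idB primeB GB]] := @exists_prime_ideal S _ x (ideal_gen_ideal_set G).
  move=> e xe; apply: radx; exists e.+1; split=> //.
  have [id0 idlin] := ideal_gen_ideal_set G.
  by rewrite exprS -[_ * _]addr0; apply: idlin.
have [F [phi phi0]] := prime_ideal_field_point idB primeB.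
rewrite -phi0 Gx ?eqxx // => y Gy; apply/eqP; rewrite phi0.
exact/GB/mem_ideal_gen.
Qed.

(** This reduces the theorem to linear algebra over a field: two radicals agree once their
    generators have the same zeros at all field-valued points. *)
Lemma radical_eq_field_points (S : comNzRingType) (G H : S -> Prop) :
  (forall (F : fieldType) (phi : {rmorphism S -> F}),
     (forall y, G y -> phi y = 0) <-> (forall y, H y -> phi y = 0)) ->
  forall x, radical (ideal_gen G) x <-> radical (ideal_gen H) x.
Proof.
move=> GH; suff sub G' H' : (forall (F : fieldType) (phi : {rmorphism S -> F}),
     (forall y, H' y -> phi y = 0) -> (forall y, G' y -> phi y = 0)) ->
  forall x, radical (ideal_gen G') x -> radical (ideal_gen H') x.
  by move=> x; split; apply: sub => F phi; apply GH.
move=> H'G' x [e [e_gt0 xe]]; apply: radical_field_points => F phi /H'G' phiG.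
by apply/eqP; move: (rmorph_ideal_gen0 phiG xe) => /eqP;
  rewrite rmorphXn expf_eq0 => /andP[].
Qed.

(** * The smallest nonvanishing minor *)

Lemma enum_val_ltn m (A : {set 'I_m}) :
  {homo (fun i : 'I_#|A| => enum_val i) : i j / (i < j)%N}.
Proof.
move=> i j lt_ij; pose x0 := enum_val i.
have sortedA : sorted (fun x y : 'I_m => (x < y)%N) (enum A).
  rewrite /enum_mem -enumT; apply: sorted_filter.
    by move=> x y z; apply: ltn_trans.
  by have := iota_ltn_sorted 0 m; rewrite -val_enum_ord sorted_map.
rewrite !(enum_val_nth x0).
apply: (sorted_ltn_nth _ x0 sortedA) => //; rewrite ?inE -?cardE //.
by move=> x y z; apply: ltn_trans.
Qed.

Lemma homo_ltn_inj m n (a : 'I_m -> 'I_n) :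
  {homo a : i j / (i < j)%N} -> injective a.
Proof.
move=> a_lt i j aij; apply: val_inj; case: (ltngtP i j) => // ij.
  by have := a_lt _ _ ij; rewrite aij ltnn.
by have := a_lt _ _ ij; rewrite aij ltnn.
Qed.

Section GreedyRows.
Variables (F : fieldType) (m n : nat) (Y : 'M[F]_(m, n)).

Definition row_span (P : pred 'I_m) := (\sum_(i | P i) <<row i Y>>)%MS.

Definition greedy_set := [set i | ~~ (row i Y <= row_span (fun j => (j < i)%N))%MS].

Lemma row_sub_span (P : pred 'I_m) i : P i -> (row i Y <= row_span P)%MS.
Proof. by move=> Pi; apply: (sumsmx_sup i); rewrite ?genmxE. Qed.

Lemma row_spanS (P Q : pred 'I_m) :
  subpred P Q -> (row_span P <= row_span Q)%MS.
Proof.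
move=> PQ; apply/sumsmx_subP => i Pi; rewrite genmxE.
exact/row_sub_span/PQ.
Qed.

Lemma rank_row_span (P : pred 'I_m) : (\rank (row_span P) <= #|P|)%N.
Proof.
rewrite -sum1_card /row_span; elim/big_rec2: _ => [|i A k Pi leAk].
  by rewrite mxrank0.
apply: leq_trans (mxrank_adds_leqif _ _).1 _.
by apply: leq_add leAk; rewrite genmxE rank_leq_row.
Qed.

Lemma row_span_greedy k :
  (row_span (fun i => (i < k)%N) <=
   row_span (fun i => (i \in greedy_set) && (i < k)%N))%MS.
Proof.
elim/ltn_ind: k => k IHk; apply/sumsmx_subP => i lt_ik; rewrite genmxE.
have [iA|] := boolP (i \in greedy_set); first by apply: row_sub_span; rewrite iA.
rewrite inE negbK => /submx_trans; apply; apply: submx_trans (IHk i lt_ik) _.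
by apply: row_spanS => j /andP[-> /= /ltn_trans]; apply.
Qed.

(** Each greedy row lies outside the span of the rows above it, so it raises the rank of the prefix
    by at least one. *)
Lemma card_greedy_prefix k :
  (#|[set i in greedy_set | (i < k)%N]| <= \rank (row_span (fun i => (i < k)%N)))%N.
Proof.
elim: k => [|k IHk].
  by rewrite (_ : [set _ in _ | _] = set0) ?cards0 //; apply/setP=> i; rewrite !inE andbF.
have sub : (row_span (fun i => (i < k)%N) <= row_span (fun i => (i < k.+1)%N))%MS.
  by apply: row_spanS => i; apply: ltnW.
case: (pickP [pred i in greedy_set | i == k :> nat]) => [i|no_k]; last first.
  apply: leq_trans (mxrankS sub); apply: leq_trans IHk; apply: subset_leq_card.
  apply/subsetP => i; rewrite !inE ltnS => /andP[iA].
  rewrite iA leq_eqVlt => /orP[ik|//].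
  by have := no_k i; rewrite !inE iA ik.
rewrite inE /= => /andP[iA /eqP ik].
have -> : [set j in greedy_set | (j < k.+1)%N] =
    i |: [set j in greedy_set | (j < k)%N].
  apply/setP => j; rewrite !inE ltnS leq_eqVlt -ik val_eqE.
  by have [->|//] := eqVneq j i; move: iA; rewrite inE => ->.
rewrite cardsU1 !inE ik ltnn andbF add1n.
apply: leq_ltn_trans IHk _; apply: rank_ltmx.
apply/andP; split=> //; apply: contraTN iA => kS; rewrite inE negbK.
apply: submx_trans (row_sub_span (P := fun j => (j < k.+1)%N) _) _.
  by rewrite ik.
by rewrite ik.
Qed.

Lemma row_span_sub (P : pred 'I_m) : (row_span P <= Y)%MS.
Proof. by apply/sumsmx_subP => i _; rewrite genmxE row_sub. Qed.

Lemma card_greedy_set : #|greedy_set| = \rank Y.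
Proof.
apply/eqP; rewrite eqn_leq; apply/andP; split.
  apply: leq_trans (leq_trans (card_greedy_prefix m) (mxrankS (row_span_sub _))).
  by apply: subset_leq_card; apply/subsetP => i iA; rewrite inE iA ltn_ord.
apply: leq_trans (rank_row_span (fun i => i \in greedy_set)).
apply/mxrankS/row_subP => i.
apply: submx_trans (row_sub_span (P := fun j => (j < m)%N) _) _ => //.
by apply: submx_trans (row_span_greedy m) (row_spanS _) => j /andP[].
Qed.

Lemma row_free_rowsub u v (h : 'I_v -> 'I_u) (M : 'M[F]_(u, n)) :
  injective h -> row_free M -> row_free (rowsub h M).
Proof.
move=> h_inj /row_freeP[B MB]; apply/row_freeP; exists (colsub h B).
apply/matrixP => i j; have /matrixP/(_ (h i) (h j)) := MB.
rewrite !mxE (inj_eq h_inj) => <-; apply: eq_bigr => k _.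
by rewrite !mxE.
Qed.

(* Choosing each row that is not in the span of the rows above it gives the
   componentwise smallest row basis. *)
Lemma smallest_row_basis r (def_r : r = \rank Y) :
  exists a : 'I_r -> 'I_m,
  [/\ {homo a : i j / (i < j)%N}, (Y <= rowsub a Y)%MS
    & forall u (c : 'I_u -> 'I_m), {homo c : i j / (i < j)%N} ->
      row_free (rowsub c Y) ->
      forall (i : 'I_r) (j : 'I_u), i = j :> nat -> (a i <= c j)%N].
Proof.
rewrite {r}def_r -card_greedy_set; exists (fun i => enum_val i); split.
- exact: enum_val_ltn.
- apply/row_subP => i.
  apply: submx_trans (row_sub_span (P := fun j => (j < m)%N) _) _ => //.
  apply: submx_trans (row_span_greedy m) _; apply/sumsmx_subP => j /andP[jA _].
  rewrite genmxE -[j in row j Y](enum_rankK_in jA jA) -row_rowsub row_sub //.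
(* If [c j] came before the [i]-th greedy row, the [j + 1] independent rows chosen by [c] up to [j]
   would lie in the span of the greedy rows above that row, of which there are only [i = j]. *)
move=> u c c_lt free_c i j ij; rewrite leqNgt; apply/negP => lt_ca.
pose h := widen_ord (ltn_ord j).
have free_ch : row_free (rowsub h (rowsub c Y)).
  by apply: row_free_rowsub => // k l /(congr1 val) /= /val_inj.
have : (\rank (rowsub h (rowsub c Y)) <= j)%N; last first.
  by move: free_ch; rewrite /row_free => /eqP->; rewrite ltnn.
pose P := [pred x in greedy_set | (x < (enum_val i : 'I_m))%N].
apply: (@leq_trans #|P|).
  apply: leq_trans (rank_row_span P); apply: mxrankS.
  apply: submx_trans (row_span_greedy (enum_val i)); apply/row_subP => k.
  rewrite !row_rowsub; apply: row_sub_span.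
  apply: leq_ltn_trans lt_ca; case: (ltngtP (h k) j) => [/c_lt/ltnW //| |/val_inj-> //].
  by move=> lt_jk; have := ltn_ord k; rewrite ltnS leqNgt lt_jk.
rewrite -ij -[X in (_ <= X)%N]card_ord.
pose g (k : 'I_i) : 'I_m := enum_val (widen_ord (ltnW (ltn_ord i)) k).
apply: leq_trans (leq_image_card g 'I_i); apply: subset_leq_card.
apply/subsetP => x /andP[xA lt_xi].
have lt_rank : (enum_rank_in xA x < i)%N.
  rewrite ltnNge leq_eqVlt; apply/negP => /orP[/eqP/val_inj iE|].
    by move: lt_xi; rewrite iE enum_rankK_in ?ltnn.
  by move=> /enum_val_ltn; rewrite enum_rankK_in // => /(ltn_trans lt_xi); rewrite ltnn.
apply/imageP; exists (Ordinal lt_rank) => //.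
by rewrite /g -[LHS](enum_rankK_in xA xA); congr enum_val; apply: val_inj.
Qed.

End GreedyRows.

Lemma homo_ltn_geq m n (a : 'I_m -> 'I_n) :
  {homo a : i j / (i < j)%N} -> forall i : 'I_m, (i <= a i)%N.
Proof.
move=> a_lt [i lt_im] /=; elim: i lt_im => // i IHi lt_im.
apply: leq_ltn_trans (IHi (ltnW lt_im)) _; exact: a_lt.
Qed.

Lemma homo_ltn_leq m n (a : 'I_m -> 'I_n) :
  {homo a : i j / (i < j)%N} -> forall i : 'I_m, (m - i <= n - a i)%N.
Proof.
(* Reversing both the source and the target keeps [a] increasing and turns the previous bound into
   this one. *)
move=> a_lt i; pose b i := rev_ord (a (rev_ord i)).
have b_lt : {homo b : i j / (i < j)%N}.
  move=> j k jk; have /a_lt : (rev_ord k < rev_ord j)%N.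
    by rewrite /=; have := ltn_ord k; lia.
  by rewrite /b /=; have := ltn_ord (a (rev_ord j)); lia.
have := homo_ltn_geq b_lt (rev_ord i); rewrite /b rev_ordK /=.
by have := ltn_ord i; have := ltn_ord (a i); lia.
Qed.

Lemma row_basis_minor (F : fieldType) r n (M : 'M[F]_(r, n)) (b : 'I_r -> 'I_n) :
  row_free M -> (M^T <= rowsub b M^T)%MS -> \det (colsub b M) != 0.
Proof.
move=> /eqP rankM Mb; rewrite -unitfE -unitmxE -row_free_unit -row_leq_rank.
rewrite -{1}rankM -mxrank_tr; apply: leq_trans (mxrankS Mb) _.
by rewrite -mxrank_tr; apply/eq_leq; congr (\rank _); apply/matrixP => i j; rewrite !mxE.
Qed.

Lemma mxsub_rowcol (R : Type) m n u v (a : 'I_u -> 'I_m) (b : 'I_v -> 'I_n)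
    (M : 'M[R]_(m, n)) :
  mxsub a b M = colsub b (rowsub a M).
Proof. by apply/matrixP => i j; rewrite !mxE. Qed.

Section Minors.
Variables (F : fieldType) (m n : nat) (Y : 'M[F]_(m, n)).

Lemma minor_neq0_free u (a : 'I_u -> 'I_m) (b : 'I_u -> 'I_n) :
  \det (mxsub a b Y) != 0 -> row_free (rowsub a Y) /\ row_free (rowsub b Y^T).
Proof.
rewrite -unitfE -unitmxE => abU; split.
  rewrite -row_leq_rank -{1}(mxrank_unit abU).
  rewrite (_ : mxsub a b Y = rowsub a Y *m colsub b 1%:M) ?mxrankM_maxl //.
  by rewrite mulmx_colsub mulmx1; apply/matrixP => i j; rewrite !mxE.
rewrite -row_leq_rank -{1}(mxrank_unit abU) -mxrank_tr.
rewrite (_ : (mxsub a b Y)^T = rowsub b Y^T *m colsub a 1%:M) ?mxrankM_maxl //.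
by rewrite mulmx_colsub mulmx1; apply/matrixP => i j; rewrite !mxE.
Qed.

Lemma minor_neq0_rank u (a : 'I_u -> 'I_m) (b : 'I_u -> 'I_n) :
  \det (mxsub a b Y) != 0 -> (u <= \rank Y)%N.
Proof.
move=> /minor_neq0_free[free_a _]; move: free_a.
by rewrite -row_leq_rank => /leq_trans; apply; apply/mxrankS/rowsub_sub.
Qed.

(** The rows and the columns are chosen greedily and independently. Columns that span all columns of
    [Y] still do so after restriction to the rows [a], so the minor does not vanish. Any other
    nonvanishing minor has independent rows and independent columns, to which the minimality of each
    choice applies. *)
Lemma smallest_minor r (def_r : r = \rank Y) :
  exists (a : 'I_r -> 'I_m) (b : 'I_r -> 'I_n),
  [/\ {homo a : i j / (i < j)%N}, {homo b : i j / (i < j)%N},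
      \det (mxsub a b Y) != 0
    & forall u (c : 'I_u -> 'I_m) (d : 'I_u -> 'I_n),
      {homo c : i j / (i < j)%N} -> {homo d : i j / (i < j)%N} ->
      \det (mxsub c d Y) != 0 ->
      (u <= r)%N /\ forall (i : 'I_r) (j : 'I_u),
        i = j :> nat -> (a i <= c j)%N && (b i <= d j)%N].
Proof.
have [a [a_lt Ya a_min]] := smallest_row_basis def_r.
have def_r' : r = \rank Y^T by rewrite mxrank_tr.
have [b [b_lt Yb b_min]] := smallest_row_basis def_r'.
exists a, b; split=> // [|u c d c_lt d_lt cd_neq0].
  rewrite mxsub_rowcol; apply: row_basis_minor.
    by rewrite -row_leq_rank {1}def_r mxrankS.
  have /submxP[D defY] := Yb; apply/submxP; exists D.
  have /matrixP defYE := defY; apply/matrixP => i j.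
  by have := defYE i (a j); rewrite !mxE => ->; apply: eq_bigr => k _; rewrite !mxE.
have [free_c free_d] := minor_neq0_free cd_neq0.
split=> [|i j ij]; first by rewrite def_r; apply: minor_neq0_rank cd_neq0.
by rewrite (a_min _ _ c_lt free_c) // (b_min _ _ d_lt free_d).
Qed.

Lemma exists_minor_neq0 t (le_t : (t <= \rank Y)%N) :
  exists (a : 'I_t -> 'I_m) (b : 'I_t -> 'I_n),
  [/\ {homo a : i j / (i < j)%N}, {homo b : i j / (i < j)%N}
    & \det (mxsub a b Y) != 0].
Proof.
have [a [a_lt Ya _]] := smallest_row_basis (erefl (\rank Y)).
pose a' := a \o widen_ord le_t; pose M := rowsub a' Y.
have free_Y : row_free (rowsub a Y) by rewrite -row_leq_rank mxrankS.
have free_M : row_free M.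
  rewrite /M /a' rowsub_comp; apply: row_free_rowsub free_Y => i j.
  by move=> /(congr1 val) /= /val_inj.
have def_t : t = \rank M^T by rewrite mxrank_tr (eqP free_M).
have [b [b_lt Mb _]] := smallest_row_basis def_t.
exists a', b; split=> //; first by move=> i j ij; apply: a_lt.
rewrite mxsub_rowcol; exact: row_basis_minor free_M Mb.
Qed.
End Minors.

(** * Sums of minors of equal weight *)

Definition increasing m n (a : {ffun 'I_m -> 'I_n}) :=
  [forall i : 'I_m, forall j : 'I_m, (i < j)%N ==> (a i < a j)%N].

Lemma increasingP m n (a : {ffun 'I_m -> 'I_n}) :
  reflect {homo a : i j / (i < j)%N} (increasing a).
Proof.
apply: (iffP 'forall_'forall_implyP) => a_lt i j; exact: a_lt.
Qed.

(** The [i]-th term is the number of positions in the hook that runs right and down from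
    [(a i, b i)] to the borders of the matrix. For increasing [a] and [b] these hooks are
    disjoint. *)
Definition minor_weight u m n (a : 'I_u -> 'I_m) (b : 'I_u -> 'I_n) :=
  (\sum_(i < u) (m - a i + (n - b i)).-1)%N.

Definition minor_sum (R : comNzRingType) m n (X : 'M[R]_(m, n)) t w : R :=
  \sum_(u < m.+1 | (t <= u)%N)
    \sum_(a : {ffun 'I_u -> 'I_m} | increasing a)
      \sum_(b : {ffun 'I_u -> 'I_n} | increasing b && (minor_weight a b == w))
        \det (mxsub a b X).

Lemma rmorph_minor_sum (R S : comNzRingType) (phi : {rmorphism R -> S}) m n
    (X : 'M[R]_(m, n)) t w :
  phi (minor_sum X t w) = minor_sum (map_mx phi X) t w.
Proof.
rewrite rmorph_sum; apply: eq_bigr => u _.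
rewrite rmorph_sum; apply: eq_bigr => a _.
rewrite rmorph_sum; apply: eq_bigr => b _.
by rewrite -det_map_mx map_mxsub.
Qed.

(** The summand [r - u] makes a minor of smaller size strictly lighter: every missing hook costs at
    least one. *)
Lemma leq_sum_ord_prefix u r (f : 'I_r -> nat) (g : 'I_u -> nat) :
  (u <= r)%N -> (forall i, 0 < f i)%N ->
  (forall (i : 'I_r) (j : 'I_u), i = j :> nat -> g j <= f i)%N ->
  (\sum_(j < u) g j + (r - u) <= \sum_(i < r) f i)%N.
Proof.
move=> le_ur f_gt0 le_gf; have [k def_r] : exists k, r = (u + k)%N.
  by exists (r - u)%N; rewrite subnKC.
subst r.
rewrite big_split_ord addKn /=; apply: leq_add.
  by apply: leq_sum => j _; apply: le_gf.
by rewrite -{1}[k]card_ord -sum1_card; apply: leq_sum.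
Qed.

Lemma sum_odd u : (\sum_(i < u) ((u - i) + (u - i)).-1 = u ^ 2)%N.
Proof.
elim: u => [|u IHu]; first by rewrite big_ord0.
by rewrite big_ord_recl /=; under eq_bigr do rewrite subSS; rewrite IHu; nia.
Qed.

Lemma minor_weight_min u m n (a : 'I_u -> 'I_m) (b : 'I_u -> 'I_n) :
  {homo a : i j / (i < j)%N} -> {homo b : i j / (i < j)%N} ->
  (u ^ 2 <= minor_weight a b)%N.
Proof.
move=> a_lt b_lt.
rewrite -sum_odd; apply: leq_sum => i _.
by have := homo_ltn_leq a_lt i; have := homo_ltn_leq b_lt i; lia.
Qed.

Lemma minor_weight_max u m n (a : 'I_u -> 'I_m) (b : 'I_u -> 'I_n) :
  {homo a : i j / (i < j)%N} -> {homo b : i j / (i < j)%N} ->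
  (minor_weight a b <= m * n)%N.
Proof.
move=> a_lt b_lt.
apply: (@leq_trans (\sum_(i < u) ((m - i) + (n - i)).-1)%N).
  apply: leq_sum => i _.
  by have := homo_ltn_geq a_lt i; have := homo_ltn_geq b_lt i; lia.
have le_um : (u <= m)%N.
  by rewrite -[u]card_ord -[m]card_ord (leq_card a) //; apply: homo_ltn_inj.
have le_un : (u <= n)%N.
  by rewrite -[u]card_ord -[n]card_ord (leq_card b) //; apply: homo_ltn_inj.
(* The hooks at the first [u] diagonal positions, together with the remaining rectangle of [m - u]
   rows and [n - u] columns, tile the matrix. *)
suff -> : (m * n =
    \sum_(i < u) ((m - i) + (n - i)).-1 + (m - u) * (n - u))%N by apply: leq_addr.
elim: u le_um le_un {a b a_lt b_lt} => [|u IHu] le_um le_un.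
  by rewrite big_ord0 !subn0.
rewrite big_ord_recr /= (IHu (ltnW le_um) (ltnW le_un)) -addnA; congr (_ + _)%N.
rewrite -[(m - u)%N]prednK ?subn_gt0 // -[(n - u)%N]prednK ?subn_gt0 // -!subnS.
by rewrite addSn addnS mulSn mulnS; lia.
Qed.

Definition last_ord t m (le_tm : (t <= m)%N) (i : 'I_t) : 'I_m :=
  rev_ord (widen_ord le_tm (rev_ord i)).

Lemma last_ord_val t m (le_tm : (t <= m)%N) (i : 'I_t) :
  last_ord le_tm i = (m - t + i)%N :> nat.
Proof. by rewrite /=; have := ltn_ord i; lia. Qed.

(** The lower bound holds term by term, so equality of the sums forces [m - a i] and [n - b i] both
    to equal [u - i]. *)
Lemma minor_weight_eq_min u m n (a : 'I_u -> 'I_m) (b : 'I_u -> 'I_n)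
    (le_um : (u <= m)%N) (le_un : (u <= n)%N) :
  {homo a : i j / (i < j)%N} -> {homo b : i j / (i < j)%N} ->
  minor_weight a b = (u ^ 2)%N -> a =1 last_ord le_um /\ b =1 last_ord le_un.
Proof.
move=> a_lt b_lt weight_ab.
pose f (i : 'I_u) := ((u - i) + (u - i)).-1.
have fP i : true -> (f i <= (m - a i + (n - b i)).-1
    ?= iff (f i == (m - a i + (n - b i)).-1))%N.
  move=> _; split=> //; rewrite /f.
  by have := homo_ltn_leq a_lt i; have := homo_ltn_leq b_lt i; lia.
have [_] := leqif_sum fP; rewrite sum_odd -/(minor_weight a b) weight_ab eqxx.
move=> /esym/forall_inP eq_f.
by split=> i; apply: ord_inj; rewrite last_ord_val;
  have /eqP := eq_f i isT; have := homo_ltn_leq a_lt i;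
  have := homo_ltn_leq b_lt i; have := ltn_ord i; have := ltn_ord (a i);
  have := ltn_ord (b i); rewrite /f; lia.
Qed.

(** The weight [w] is that of the smallest nonvanishing minor. Every other nonvanishing minor is
    strictly lighter, so the sum of weight [w] reduces to a single nonzero term. *)
Lemma minor_sum_neq0 (F : fieldType) m n (Y : 'M[F]_(m, n)) t
    (le_tm : (t <= m)%N) (le_tn : (t <= n)%N) :
  (0 < t)%N -> (t <= \rank Y)%N ->
  exists w, [/\ (t ^ 2 <= w <= m * n)%N, minor_sum Y t w != 0
    & w = (t ^ 2)%N ->
      (forall i j, ~~ in_last_block t (i, j) -> Y i j = 0) /\
      \det (mxsub (last_ord le_tm) (last_ord le_tn) Y) != 0].
Proof.
move=> t_gt0; have := erefl (\rank Y); move: {1 3}(\rank Y) => r def_r le_tr.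
have [a [b [a_lt b_lt ab_neq0 ab_min]]] := smallest_minor def_r.
have lt_rm : (r < m.+1)%N by rewrite ltnS def_r rank_leq_row.
have le_rn : (r <= n)%N by rewrite def_r rank_leq_col.
pose f (i : 'I_r) := (m - a i + (n - b i)).-1.
have f_gt0 i : (0 < f i)%N.
  by rewrite /f; have := ltn_ord (a i); have := ltn_ord (b i); lia.
(* Equal weight first forces equal size, since missing hooks would be a loss, and then equality of
   all the hooks; the componentwise comparison then gives the same rows and columns. *)
have unique u (c : 'I_u -> 'I_m) (d : 'I_u -> 'I_n) :
    {homo c : i j / (i < j)%N} -> {homo d : i j / (i < j)%N} ->
    minor_weight c d = minor_weight a b -> \det (mxsub c d Y) != 0 ->
    u = r /\ forall (i : 'I_r) (j : 'I_u), i = j :> nat -> c j = a i /\ d j = b i.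
  move=> c_lt d_lt weight_cd /(ab_min _ _ _ c_lt d_lt)[le_ur le_ab].
  pose g (j : 'I_u) := (m - c j + (n - d j)).-1.
  have le_gf (i : 'I_r) (j : 'I_u) : i = j :> nat -> (g j <= f i)%N.
    by move=> /le_ab/andP[]; rewrite /f /g; lia.
  have def_u : u = r.
    have : (minor_weight c d + (r - u) <= minor_weight a b)%N.
      exact: leq_sum_ord_prefix le_ur f_gt0 le_gf.
    by rewrite weight_cd; lia.
  subst u; split=> // i j /ord_inj->.
  have gfP k : true -> (g k <= f k ?= iff (g k == f k))%N.
    by move=> _; split=> //; apply: le_gf.
  have [_] := leqif_sum gfP.
  rewrite -/(minor_weight c d) -/(minor_weight a b) weight_cd eqxx.
  move=> /esym/forall_inP/(_ j isT)/eqP; rewrite /f /g.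
  have /andP[] := le_ab j j erefl.
  by have := ltn_ord (c j); have := ltn_ord (d j); split; apply: ord_inj; lia.
exists (minor_weight a b); split.
- rewrite minor_weight_max // andbT; apply: leq_trans (minor_weight_min a_lt b_lt).
  by rewrite leq_exp2r.
- pose fa := [ffun i => a i]; pose fb := [ffun i => b i].
  have fa_lt : increasing fa by apply/increasingP => i j; rewrite !ffunE; apply: a_lt.
  have fb_lt : increasing fb by apply/increasingP => i j; rewrite !ffunE; apply: b_lt.
  have weight_f : minor_weight fa fb = minor_weight a b.
    by apply: eq_bigr => i _; rewrite !ffunE.
  rewrite /minor_sum (bigD1 (Ordinal lt_rm)) //= [X in _ + X]big1 ?addr0; last first.
    move=> u /andP[_ neq_ur]; rewrite big1 // => c /increasingP c_lt.
    rewrite big1 // => d /andP[/increasingP d_lt /eqP weight_cd].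
    apply/eqP; apply: contraNT neq_ur => /(unique _ _ _ c_lt d_lt weight_cd)[ur _].
    by apply/eqP/val_inj.
  rewrite (bigD1 fa) //= [X in _ + X]big1 ?addr0; last first.
    move=> c /andP[/increasingP c_lt neq_cf].
    rewrite big1 // => d /andP[/increasingP d_lt /eqP weight_cd].
    apply/eqP; apply: contraNT neq_cf.
    move=> /(unique _ _ _ c_lt d_lt weight_cd)[_ cE].
    by apply/eqP/ffunP => i; rewrite ffunE; case: (cE i i erefl).
  rewrite (bigD1 fb) /= ?fb_lt ?weight_f ?eqxx // [X in _ + X]big1 ?addr0; last first.
    move=> d /andP[/andP[/increasingP d_lt /eqP weight_cd]].
    apply: contraNeq; have /increasingP fa_lt' := fa_lt.
    move=> /(unique _ _ _ fa_lt' d_lt weight_cd)[_ dE].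
    by apply/eqP/ffunP => i; rewrite ffunE; case: (dE i i erefl).
  rewrite (_ : mxsub fa fb Y = mxsub a b Y) //.
  by apply/matrixP => i j; rewrite !mxE !ffunE.
move=> weight_ab.
(* The weight is at least [r ^ 2], so weight [t ^ 2] leaves only [r = t], and the minor is that of
   the last block. *)
have def_r' : r = t.
  apply/eqP; rewrite eqn_leq le_tr andbT -(@leq_exp2r _ _ 2) // -weight_ab.
  exact: minor_weight_min.
subst t; have [aE bE] := minor_weight_eq_min le_tm le_tn a_lt b_lt weight_ab.
split; last first.
  by move: ab_neq0; congr (\det _ != 0); apply/matrixP => i j; rewrite !mxE aE bE.
(* A nonzero entry is a nonvanishing minor of size 1, so it lies weakly below and to the right of
   the first corner of the smallest minor, that is, inside the last block. *)
move=> i j; apply: contraNeq => Yij.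
have [//|//||_ /(_ (Ordinal t_gt0) ord0 erefl)] :=
    ab_min 1%N (fun=> i) (fun=> j).
- by move=> [[|//] ?] [[|//] ?].
- by move=> [[|//] ?] [[|//] ?].
- by rewrite det_mx11 !mxE.
by rewrite aE bE !last_ord_val /in_last_block /= !addn0.
Qed.

(** * The curve attached to an algebraic relation *)

Lemma base_digits_inj k q (f g : 'I_k -> nat) :
  (forall i, f i < q)%N -> (forall i, g i < q)%N ->
  (\sum_(i < k) q ^ i * f i = \sum_(i < k) q ^ i * g i)%N -> f =1 g.
Proof.
elim: k f g => [|k IHk] f g lt_f lt_g; first by move=> _ [].
rewrite !big_ord_recl !expn0 !mul1n.
under eq_bigr do rewrite /= /bump /= expnS -mulnA.
under [in RHS]eq_bigr do rewrite /= /bump /= expnS -mulnA.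
rewrite -!big_distrr /= => eq_fg.
have eq0 : f ord0 = g ord0.
  have := congr1 (modn^~ q) eq_fg.
  by rewrite ![(_ + q * _)%N]addnC ![(q * _)%N]mulnC !modnMDl !modn_small.
move: eq_fg; rewrite eq0 => /addnI/eqP; rewrite eqn_pmul2l; last first.
  exact: leq_ltn_trans (lt_f ord0).
move=> /eqP/IHk eqS i; case: (unliftP ord0 i) => [j ->|-> //].
by apply: eqS.
Qed.

Lemma rmorph_mmap (R S T : comNzRingType) (f : {rmorphism R -> S})
    (psi : {rmorphism S -> T}) k (h : 'I_k -> S) (P : {mpoly R[k]}) :
  psi (mmap f h P) = mmap (psi \o f) (psi \o h) P.
Proof.
rewrite /mmap rmorph_sum; apply: eq_bigr => a _; rewrite rmorphM; congr (_ * _).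
by rewrite /mmap1 rmorph_prod; apply: eq_bigr => i _; rewrite rmorphXn.
Qed.

(* Kronecker substitution: for [q] larger than the degree of [P] the monomials
   of [P] become distinct powers of ['X], so nothing cancels. *)
Lemma kronecker_subst_neq0 (K : fieldType) k (P : {mpoly K[k]}) : P != 0 ->
  mmap (@polyC K) (fun i : 'I_k => 'X^(msize P ^ i)) P != 0.
Proof.
move=> P_neq0; pose e (a : 'X_{1..k}) := (\sum_(i < k) msize P ^ i * a i)%N.
have mmap1E a : mmap1 (fun i : 'I_k => 'X^(msize P ^ i)) a = 'X^(e a) :> {poly K}.
  rewrite /mmap1 /e; under eq_bigr do rewrite -exprM.
  by elim/big_rec2: _ => // i p q _ ->; rewrite exprD.
have lt_digit a i : a \in msupp P -> (a i < msize P)%N.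
  move=> /msize_mdeg_lt; apply: leq_ltn_trans.
  by rewrite mdegE (bigD1 i) //= leq_addr.
have aP := mlead_supp P_neq0; move: (mlead P) aP => a aP.
suff: (mmap (@polyC K) (fun i : 'I_k => 'X^(msize P ^ i)) P)`_(e a) = P@_a.
  by move=> coef_a; apply: contraTneq aP => P0; rewrite -mcoeff_eq0 -coef_a P0 coef0.
rewrite /mmap coef_sum (bigD1_seq a) ?msupp_uniq //= big_seq_cond big1.
  by rewrite addr0 mmap1E coefCM coefXn eqxx mulr1.
move=> b /andP[bP neq_ba]; rewrite mmap1E coefCM coefXn.
case: eqP => [eab|_]; last by rewrite mulr0.
case/eqP: neq_ba; apply/mnmP => i; apply/esym.
exact: base_digits_inj (fun i => lt_digit a i aP) (fun i => lt_digit b i bP) eab i.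
Qed.

(* [W] collects the factor of the Kronecker specialisation of [P] that does not
   vanish at the origin. *)
Lemma annihilating_curve (K : fieldType) k (P : {mpoly K[k]}) : P != 0 ->
  exists (q : nat) (W : {poly K}), [/\ (0 < q)%N, W.[0] != 0
    & forall (F : fieldType) (iota : {rmorphism K -> F}) (y : 'I_k -> F) (s : F),
      mmap iota y P = 0 -> (forall i, y i = s ^+ (q ^ i)) ->
      s = 0 \/ (map_poly iota W).[s] = 0].
Proof.
move=> P_neq0; have kron_neq0 := kronecker_subst_neq0 P_neq0.
(* Dividing out the root 0 writes the specialisation as [W * 'X^r] with [W.[0] != 0]; evaluated at
   [s] it gives the value of [P] at [y], which is 0. *)
have [r [W W0 kronE]] :=
  multiplicity_XsubC (mmap (@polyC K) (fun i : 'I_k => 'X^(msize P ^ i)) P) 0.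
exists (msize P), W; split.
- by rewrite lt0n msize_poly_eq0.
- by move: W0; rewrite kron_neq0 => /=; rewrite /root.
move=> F iota y s Py0 yE; move: (congr1 (fun p => (map_poly iota p).[s]) kronE).
have -> : (map_poly iota (mmap (@polyC K) (fun i : 'I_k => 'X^(msize P ^ i)) P)).[s] =
    mmap iota y P.
  have horner_map_C c : (map_poly iota c%:P).[s] = iota c.
    by rewrite map_polyC hornerC.
  rewrite /mmap rmorph_sum horner_sum; apply: eq_bigr => a _.
  rewrite rmorphM hornerM /= horner_map_C; congr (_ * _).
  rewrite /mmap1 rmorph_prod horner_prod; apply: eq_bigr => i _.
  by rewrite !rmorphXn /= map_polyX !horner_exp hornerX yE.
rewrite Py0 rmorphM /= hornerM rmorphXn /= rmorphB /= map_polyX map_polyC /= rmorph0.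
rewrite subr0 horner_exp hornerX => /esym/eqP; rewrite mulf_eq0 expf_eq0.
by move=> /orP[/eqP|/andP[_ /eqP]]; [right|left].
Qed.

(** * Perturbation of the outer entries *)

Lemma is_ara_exists (S : comNzRingType) (I : S -> Prop) d (f : 'I_d -> S) :
  generates_up_to_radical I f -> exists r, is_ara I r /\ (r <= d)%N.
Proof.
move=> If; pose P r := `[< exists g : 'I_r -> S, generates_up_to_radical I g >].
have exP : exists r, P r by exists d; apply/asboolP; exists f.
have [r /asboolP Ir r_min] := ex_minnP exP.
exists r; split; last by apply: r_min; apply/asboolP; exists f.
by split=> // s g Ig; apply: r_min; apply/asboolP; exists g.
Qed.

Lemma minors_eq0_rank (F : fieldType) m n (Y : 'M[F]_(m, n)) t :
  (forall y, is_minor Y t y -> y = 0) <-> (\rank Y < t)%N.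
Proof.
split=> [Y0|lt_Yt y [a [b [a_lt b_lt ->]]]].
  rewrite ltnNge; apply/negP => /exists_minor_neq0[a [b [a_lt b_lt]]].
  by apply/negP; rewrite negbK; apply/eqP; apply: Y0; exists a, b.
apply/eqP; apply: contraTT lt_Yt => /minor_neq0_rank.
by rewrite -leqNgt.
Qed.

Lemma rmorph_minors_eq0 (S : comNzRingType) (F : fieldType)
    (phi : {rmorphism S -> F}) m n (X : 'M[S]_(m, n)) t :
  (forall y, is_minor X t y -> phi y = 0) <->
  (forall y, is_minor (map_mx phi X) t y -> y = 0).
Proof.
split=> [X0 y [a [b [a_lt b_lt ->]]]|X0 y [a [b [a_lt b_lt ->]]]].
  by rewrite -map_mxsub det_map_mx; apply: X0; exists a, b.
by rewrite -det_map_mx map_mxsub; apply: X0; exists a, b.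
Qed.

Lemma minor_sum_small_rank (F : fieldType) m n (Y : 'M[F]_(m, n)) t w :
  (\rank Y < t)%N -> minor_sum Y t w = 0.
Proof.
move=> lt_Yt; apply: big1 => u le_tu; apply: big1 => a _; apply: big1 => b _.
apply/eqP; apply: contraTT lt_Yt => /minor_neq0_rank le_uY.
by rewrite -leqNgt (leq_trans le_tu).
Qed.

Lemma last_ord_lt t m (le_tm : (t <= m)%N) :
  {homo last_ord le_tm : i j / (i < j)%N}.
Proof. by move=> i j; rewrite !last_ord_val ltn_add2l. Qed.

Theorem theorem3p1 (K : closedFieldType) (N m n : nat)
    (m_gt0 : (0 < m)%N) (le_mn : (m <= n)%N)
    (X : 'M[{mpoly K[N]}]_(m, n)) (t : nat)
    (t_gt0 : (1 <= t)%N) (le_tm : (t <= m)%N) (lt_tn : (t < n)%N)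
    (X_dep : entries_alg_dependent X (fun p => ~~ in_last_block t p)) :
  exists r : nat, is_ara (minor_ideal X t) r /\ (r <= m * n - t ^ 2)%N.
Proof.
have [k [u [P [u_inj u_out P_neq0 P_dep]]]] := X_dep.
(* A relation between no entries would be a nonzero constant equal to 0. Hence there is a first
   entry, at [u ord0]. *)
case: k => [|k] in u P u_inj u_out P_neq0 P_dep *.
  case/eqP: P_neq0; move: P_dep; rewrite [P]nvar0_mpolyC comp_mpolyC.
  by move=> /eqP; rewrite mpolyC_eq0 => /eqP->.
have [q [W [q_gt0 W0 on_curve]]] := annihilating_curve P_neq0.
have le_tn := ltnW lt_tn.
pose delta := \det (mxsub (last_ord le_tm) (last_ord le_tn) X).
pose x0 := X (u ord0).1 (u ord0).2.
pose v := - delta * (map_poly (@mpolyC N K) W).[x0].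
(* Only the entries in the relation are perturbed. As [u] is injective, each sum has at most one
   term. *)
pose X' := \matrix_(i, j) (X i j - \sum_(l | u l == (i, j)) v ^+ (q ^ l)).
(* The shift [i.+1] leaves out the weight [t ^ 2], so the weights are exactly those from [t ^ 2 + 1]
   to [m * n]. *)
pose f (i : 'I_(m * n - t ^ 2)) := minor_sum X' t (t ^ 2 + i.+1)%N.
suff /is_ara_exists : generates_up_to_radical (minor_ideal X t) f by [].
apply: radical_eq_field_points => F phi.
pose Y := map_mx phi X; pose Y' := map_mx phi X'.
have deltaE : phi delta = \det (mxsub (last_ord le_tm) (last_ord le_tn) Y).
  by rewrite -map_mxsub det_map_mx.
have Y'E i j : Y' i j = Y i j - \sum_(l | u l == (i, j)) phi v ^+ (q ^ l).
  rewrite !mxE rmorphB rmorph_sum; congr (_ - _).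
  by apply: eq_bigr => l _; rewrite rmorphXn.
have Y'_delta0 : phi delta = 0 -> Y' = Y.
  move=> delta0; apply/matrixP => i j; rewrite Y'E big1 ?subr0 // => l _.
  by rewrite rmorphM rmorphN delta0 oppr0 mul0r expr0n gtn_eqF // expn_gt0 q_gt0.
have delta_rank (Z : 'M[F]_(m, n)) : (\rank Z < t)%N ->
    \det (mxsub (last_ord le_tm) (last_ord le_tn) Z) = 0.
  move=> /minors_eq0_rank; apply; exists (last_ord le_tm), (last_ord le_tn).
  by split; [apply: last_ord_lt|apply: last_ord_lt|].
(* The perturbed positions lie outside the last block, so [delta] can be read off [Y'] as well. *)
have block_eq : mxsub (last_ord le_tm) (last_ord le_tn) Y' =
    mxsub (last_ord le_tm) (last_ord le_tn) Y.
  apply/matrixP => i j; rewrite [LHS]mxE [RHS]mxE Y'E big_pred0 ?subr0 // => l.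
  apply/negP => /eqP ul; have := u_out l.
  by rewrite ul /in_last_block !last_ord_val !leq_addr.
rewrite rmorph_minors_eq0 minors_eq0_rank -/Y; split=> [rankY y [i ->]|g0].
  rewrite rmorph_minor_sum -/Y'.
  by rewrite Y'_delta0 ?minor_sum_small_rank // deltaE delta_rank.
(* If [Y'] has rank below [t], its last block is singular, so [delta] vanishes at the point and
   [Y = Y']. The other case leads to a contradiction. *)
have [lt_Y't|le_tY'] := ltnP (\rank Y') t.
  by rewrite -Y'_delta0 // deltaE -block_eq delta_rank.
have [w [/andP[ge_w le_w] w_neq0 w_min]] := minor_sum_neq0 le_tm le_tn t_gt0 le_tY'.
have /w_min[Y'0 delta_neq0] : w = (t ^ 2)%N.
  apply/eqP; rewrite eqn_leq ge_w andbT leqNgt; apply/negP => lt_w.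
  have lt_i : (w - (t ^ 2).+1 < m * n - t ^ 2)%N by lia.
  case/eqP: w_neq0; have := g0 _ (ex_intro _ (Ordinal lt_i) erefl).
  by rewrite rmorph_minor_sum -/Y' /= (_ : (t ^ 2 + _)%N = w) //; lia.
pose iota : {rmorphism K -> F} := phi \o @mpolyC N K.
(* The outer entries of [Y'] vanish, so those of [Y] in the relation lie on the curve with parameter
   [phi v]. *)
have YuE l : Y (u l).1 (u l).2 = phi v ^+ (q ^ l).
  have /eqP : Y' (u l).1 (u l).2 = 0 by apply: Y'0; rewrite -surjective_pairing.
  rewrite Y'E subr_eq0 => /eqP->; rewrite -surjective_pairing.
  by apply: big_pred1 => l'; rewrite (inj_eq u_inj).
have P_Y : mmap iota (fun l => Y (u l).1 (u l).2) P = 0.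
  have := congr1 phi P_dep; rewrite rmorph0 /comp_mpoly rmorph_mmap => <-.
  by congr (mmap _ _ P); apply/funext => l /=; rewrite tnth_mktuple mxE.
(* For [l = 0] the exponent [q ^ 0] is 1, so [x0] and [v] agree at the point and the definition of
   [v] becomes a fixed-point equation. *)
have s_fix : phi v = - phi delta * (map_poly iota W).[phi v].
  have x0E : phi x0 = phi v by have := YuE ord0; rewrite expn0 expr1 mxE.
  by rewrite -[in RHS]x0E /v rmorphM rmorphN -horner_map -map_poly_comp.
(* Either alternative gives [phi v = 0], the second through [s_fix]. Then [W.[0] = 0] follows, from
   [s_fix] and the nonvanishing of [delta] in the first case, and directly in the second. *)
case: (on_curve F iota _ _ P_Y YuE) => [s0|Ws0].
  move: s_fix; rewrite s0 => /esym/eqP; rewrite mulf_eq0 oppr_eq0 deltaE -block_eq.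
  rewrite (negPf delta_neq0) /= -[X in _.[X]](rmorph0 iota) horner_map fmorph_eq0.
  by rewrite (negPf W0).
have s0 : phi v = 0 by rewrite s_fix Ws0 mulr0.
move: Ws0; rewrite s0 -[X in _.[X]](rmorph0 iota) horner_map => /eqP.
by rewrite fmorph_eq0 (negPf W0).
Qed.
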